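(* For all integers $n\ge 1$ and $1\le k\le n$, $$S_q[n,k]=\sum_{w\in\mathcal A(n,k)} q^{A(w)}\,(1+q)^{B(w)} .$$ Consequently, $S_q[n,k]$ evaluated at $q=-1$ equals the number of weakly increasing words in $\mathcal A(n,k)$.
   Context: An RG-word (restricted growth word) of length $n$ with maximum letter $k$ is a word $w=w_1\cdots w_n$ of positive integers with $w_1=1$, $w_i\le \max(w_1,\dots,w_{i-1})+1$ for $2\le i\le n$, and $\max(w_1,\dots,w_n)=k$; $\mathcal R(n,k)$ denotes the set of these. A word $w\in\mathcal R(n,k)$ is allowable if every even letter occurring in $w$ occurs exactly once; $\mathcal A(n,k)$ is the set of allowable words in $\mathcal R(n,k)$. For $w\in\mathcal R(n,k)$ put $m_i=\max(w_1,\dots,w_i)$. Define $A(w)=\sum_{i=2}^n A_i(w)$ and $B(w)=\sum_{i=2}^n B_i(w)$, where $A_i(w)=w_i-1$ if $m_{i-1}\ge w_i$ and $A_i(w)=0$ if $m_{i-1}<w_i$; and $B_i(w)=1$ if $m_{i-1}>w_i$ and $B_i(w)=0$ otherwise. Let $[k]_q=1+q+\cdots+q^{k-1}$. The $q$-Stirling numbers of the second kind are defined by $S_q[n,k]=S_q[n-1,k-1]+[k]_q\,S_q[n-1,k]$ for $1\le k\le n$, with $S_q[n,0]=\delta_{n,0}$, $S_q[0,k]=\delta_{0,k}$, and $S_q[n,k]=0$ for $k>n$. *)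

(* Defs.v *)
From HB Require Import structures.
From mathcomp Require Import all_boot all_order all_algebra.
Set Implicit Arguments.
Unset Strict Implicit.
Unset Printing Implicit Defensive.
Import Order.TTheory GRing.Theory Num.Theory.

(* Positions are numbered from 1, so w_i is [letter w i]. *)
Definition letter (w : seq nat) (i : nat) : nat := nth 0 w i.-1.

Definition prefix_max (w : seq nat) (i : nat) : nat :=
  \max_(1 <= j < i.+1) letter w j.

(* The empty word is excluded, as [letter [::] 1 = 0]. *)
Definition is_RG (k : nat) (w : seq nat) : bool :=
  [&& all (leq 1) w,
      letter w 1 == 1,
      all (fun i => letter w i <= (prefix_max w i.-1).+1)
          (index_iota 2 (size w).+1)
    & prefix_max w (size w) == k].

Definition allowable (w : seq nat) : bool :=
  all (fun a => ~~ odd a ==> (count_mem a w == 1)) w.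

Definition statA_at (w : seq nat) (i : nat) : nat :=
  if letter w i <= prefix_max w i.-1 then (letter w i).-1 else 0.

Definition statB_at (w : seq nat) (i : nat) : nat :=
  if letter w i < prefix_max w i.-1 then 1 else 0.

Definition statA (w : seq nat) : nat :=
  \sum_(2 <= i < (size w).+1) statA_at w i.

Definition statB (w : seq nat) : nat :=
  \sum_(2 <= i < (size w).+1) statB_at w i.

(* A word whose maximum letter is k has all its letters in {0, ..., k}, so
   tuples over 'I_k.+1 provide a finite carrier without losing any word
   (lemma RG_wordsP below). *)
Definition word n k (w : n.-tuple 'I_k.+1) : seq nat :=
  [seq nat_of_ord a | a <- w].

Definition RG_words (n k : nat) : {set n.-tuple 'I_k.+1} :=
  [set w | is_RG k (word w)].

Definition allowable_words (n k : nat) : {set n.-tuple 'I_k.+1} :=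
  [set w in RG_words n k | allowable (word w)].

Lemma RG_wordsP (n k : nat) (s : seq nat) :
  reflect (exists2 w, w \in RG_words n k & word w = s)
          ((size s == n) && is_RG k s).
Proof.
apply: (iffP andP) => [[/eqP sz_s rg_s] | [w]]; last first.
  by rewrite inE => rg_w <-; rewrite size_map size_tuple eqxx.
have /and4P[_ _ _ /eqP max_s] := rg_s.
have le_s a : a \in s -> a <= k.
  move=> s_a; rewrite -max_s -(nth_index 0 s_a) /prefix_max.
  apply: (@leq_bigmax_seq _ _ xpredT (letter s) (index a s).+1) => //.
  by rewrite mem_index_iota /= ltnS index_mem.
have sz_t : size [seq inord a : 'I_k.+1 | a <- s] == n by rewrite size_map sz_s.
have eq_s : word (Tuple sz_t) = s.
  rewrite /word /= -map_comp -[RHS]map_id; apply/eq_in_map => a /le_s le_a.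
  by rewrite /= inordK.
by exists (Tuple sz_t); rewrite ?inE eq_s.
Qed.

Local Open Scope ring_scope.

(* The variable q is the indeterminate 'X of {poly int}. *)
Definition qint (k : nat) : {poly int} := \sum_(i < k) 'X^i.

Fixpoint qStirling (n k : nat) : {poly int} :=
  match n, k with
  | 0, 0 => 1
  | 0, _.+1 => 0
  | _.+1, 0 => 0
  | n'.+1, k'.+1 =>
      if (k'.+1 <= n'.+1)%N
      then qStirling n' k' + qint k'.+1 * qStirling n' k'.+1
      else 0
  end.

(* Main.v *)
(** An allowable word of length n + 1 arises from a unique allowable word w of
    length n by appending a letter a. If k = max w, then a = k + 1 contributes
    the factor 1. Otherwise 1 <= a <= k, and a must be odd, since every letter
    1, ..., k already occurs in w; the odd a < k contribute q^(a-1) (1 + q) each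
    and a = k, when k is odd, contributes q^(k-1), which add up to [k]_q. Hence
    the right-hand side obeys the recurrence of the q-Stirling numbers.
    At q = -1 only the words with B(w) = 0 survive, which are the weakly
    increasing ones; their repeated letters are odd, so A(w) is even. *)
Require Import Defs.
From HB Require Import structures.
From mathcomp Require Import all_boot all_order all_algebra.
From mathcomp Require Import zify.
Set Implicit Arguments.
Unset Strict Implicit.
Import Order.TTheory GRing.Theory Num.Theory.
Local Open Scope ring_scope.

(** * Letters, maxima and statistics under appending a letter *)

Lemma letter_rcons s a i : (0 < i <= size s)%N -> letter (rcons s a) i = letter s i.
Proof. by case: i => // i /= lt_i; rewrite /letter nth_rcons lt_i. Qed.

Lemma letter_rcons_last s a : letter (rcons s a) (size s).+1 = a.
Proof. by rewrite /letter nth_rcons ltnn eqxx. Qed.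

Lemma prefix_max_rcons s a i :
  (i <= size s)%N -> prefix_max (rcons s a) i = prefix_max s i.
Proof.
move=> le_i; apply: eq_big_nat => j /andP[j_gt0 lt_j].
by rewrite letter_rcons // j_gt0 (leq_trans _ le_i).
Qed.

Lemma prefix_max_size s : prefix_max s (size s) = (\max_(x <- s) x)%N.
Proof. by rewrite (big_nth 0%N) /prefix_max big_add1. Qed.

Lemma prefix_max_size_rcons s a :
  prefix_max (rcons s a) (size (rcons s a)) = maxn (prefix_max s (size s)) a.
Proof. by rewrite !prefix_max_size -cats1 big_cat big_seq1. Qed.

(** Shared by [statA] and [statB]. As [s] is nonempty, the new position is at least 2 and so lies in
    the summation range. *)
Lemma sum_stat_rcons (st : seq nat -> nat -> nat) s a : (0 < size s)%N ->
    (forall i, (1 < i <= size s)%N -> st (rcons s a) i = st s i) ->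
  (\sum_(2 <= i < (size (rcons s a)).+1) st (rcons s a) i =
   \sum_(2 <= i < (size s).+1) st s i + st (rcons s a) (size s).+1)%N.
Proof.
move=> s_gt0 eq_st; rewrite size_rcons big_nat_recr //=; congr addn.
by apply: eq_big_nat => i; rewrite ltnS => /eq_st.
Qed.

Lemma statA_rcons s a (M := prefix_max s (size s)) : (0 < size s)%N ->
  statA (rcons s a) = (statA s + if a <= M then a.-1 else 0)%N.
Proof.
move=> s_gt0; rewrite /statA sum_stat_rcons //; last first.
  move=> i /andP[i_gt1 le_i]; rewrite /statA_at letter_rcons ?prefix_max_rcons //; lia.
by rewrite {2}/statA_at letter_rcons_last prefix_max_rcons.
Qed.

Lemma statB_rcons s a (M := prefix_max s (size s)) : (0 < size s)%N ->
  statB (rcons s a) = (statB s + (a < M))%N.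
Proof.
move=> s_gt0; rewrite /statB sum_stat_rcons //; last first.
  move=> i /andP[i_gt1 le_i]; rewrite /statB_at letter_rcons ?prefix_max_rcons //; lia.
by rewrite {2}/statB_at letter_rcons_last prefix_max_rcons //; case: ifP.
Qed.

(** * Last letters of RG-words and of allowable words *)

Lemma is_RG_max k s : is_RG k s -> prefix_max s (size s) = k.
Proof. by case/and4P=> _ _ _ /eqP. Qed.

Lemma is_RG_rcons k s a (M := prefix_max s (size s)) : (0 < size s)%N ->
  is_RG k (rcons s a) =
    [&& is_RG M s, (0 < a)%N, (a <= M.+1)%N & maxn M a == k].
Proof.
move=> s_gt0; rewrite /is_RG prefix_max_size_rcons -/M eqxx andbT all_rcons.
rewrite letter_rcons // size_rcons /index_iota.
(* Splits off the last position; the subtraction is truncated, so this needs [s] nonempty. *)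
have -> : ((size s).+2 - 2 = ((size s).+1 - 2) + 1)%N by lia.
rewrite iotaD all_cat.
have -> : (2 + ((size s).+1 - 2) = (size s).+1)%N by lia.
rewrite /= andbT letter_rcons_last prefix_max_rcons // -/M.
set b := all _ (iota _ _); set c := all _ (iota _ _).
have -> : b = c.
  apply: eq_in_all => i; rewrite mem_iota => /andP[i_ge2 lt_i].
  rewrite letter_rcons ?prefix_max_rcons //; lia.
by case: (0 < a)%N; case: (all (leq 1) s); case: (letter s 1 == _); case: c => //=;
  rewrite ?andbF ?andbT.
Qed.

Lemma is_RG_size_gt0 k s : is_RG k s -> (0 < size s)%N.
Proof. by case: s => // /and3P[]. Qed.

Lemma is_RG_seq1 k a : is_RG k [:: a] = (a == 1%N) && (k == 1%N).
Proof.
rewrite /is_RG prefix_max_size big_seq1 /letter /= andbT.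
by case: a => [|[|a]] //=; rewrite eq_sym.
Qed.

(** The running maximum grows by at most one at a time, so no letter is skipped. *)
Lemma is_RG_mem k s a : is_RG k s -> (0 < a <= k)%N -> a \in s.
Proof.
elim/last_ind: s k a => [|s b IHs] k a; first by move/is_RG_size_gt0.
have [/size0nil->|s_gt0] := posnP (size s).
  by rewrite is_RG_seq1 => /andP[/eqP-> /eqP->]; rewrite inE; lia.
rewrite is_RG_rcons // => /and4P[RGs b_gt0 le_b /eqP <-] a_bnd.
rewrite mem_rcons inE; have [//|a_ne_b] := eqVneq a b.
by apply: IHs RGs _; move: (prefix_max s _) a_bnd le_b a_ne_b => M; lia.
Qed.

Lemma mem_leq_prefix_max s a : a \in s -> (a <= prefix_max s (size s))%N.
Proof. by move=> s_a; rewrite prefix_max_size; apply: leq_bigmax_seq. Qed.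

Lemma is_RG_gt0 k s : is_RG k s -> (0 < k)%N.
Proof.
case: s => [|a s] RGs; first by have := is_RG_size_gt0 RGs.
rewrite -(is_RG_max RGs); have /and4P[/andP[a_gt0 _] _ _ _] := RGs.
by apply: leq_trans a_gt0 (mem_leq_prefix_max _); apply: mem_head.
Qed.

(** An even [a] already in [s] would occur twice; otherwise the even letters of [s] differ from [a]
    and keep their counts. *)
Lemma allowable_rcons s a :
  allowable (rcons s a) = allowable s && ((a \in s) ==> odd a).
Proof.
rewrite /allowable all_rcons.
have cnt b : count_mem b (rcons s a) = (count_mem b s + (a == b))%N.
  by rewrite -cats1 count_cat /= addn0.
apply/andP/andP => [[a_ok /allP s_ok] | [/allP s_ok a_ok]]; split.
- apply/allP => b s_b; apply/implyP => even_b.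
  move: (implyP (s_ok b s_b) even_b); rewrite cnt.
  by move: s_b; rewrite -has_pred1 has_count; lia.
- apply/implyP => s_a; apply: contraLR a_ok => even_a.
  rewrite even_a /= cnt eqxx; by move: s_a; rewrite -has_pred1 has_count; lia.
- apply/implyP => even_a; rewrite cnt eqxx.
  have: a \notin s by apply: contra even_a => s_a; apply: (implyP a_ok).
  by move/count_memPn->.
apply/allP => b s_b; apply/implyP => even_b.
rewrite cnt (eqP (implyP (s_ok b s_b) even_b)); case: (a =P b) => // ab.
by move: even_b; rewrite -ab (implyP a_ok) ?ab.
Qed.

(** * Recursive enumeration of the allowable words *)

(* [allowable_seqs n k] lists words of length [n.+1]. *)
Fixpoint allowable_seqs (n k : nat) : seq (seq nat) :=
  match n, k with
  | _, 0 => [::]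
  | 0, k'.+1 => if k' == 0%N then [:: [:: 1%N]] else [::]
  | n'.+1, k'.+1 =>
      [seq rcons s k | s <- allowable_seqs n' k'] ++
      [seq rcons s a | s <- allowable_seqs n' k, a <- [seq a <- iota 1 k | odd a]]
  end.

Lemma allowable_seqsS n k :
  allowable_seqs n.+1 k.+1 =
    [seq rcons s k.+1 | s <- allowable_seqs n k] ++
    [seq rcons s a | s <- allowable_seqs n k.+1,
                     a <- [seq a <- iota 1 k.+1 | odd a]].
Proof. by []. Qed.

Lemma mem_allowable_seqs n k s :
  (s \in allowable_seqs n k) = [&& size s == n.+1, is_RG k s & allowable s].
Proof.
elim: n k s => [|n IHn] k s.
  case: s => [|a [|b s]] /=.
  - by case: k => [|[|k]].
  - rewrite is_RG_seq1 /allowable /= eqxx /= implybT.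
    by case: k => [|[|k]] //=; rewrite ?andbF ?andbT // inE eqseq_cons andbT.
  - by case: k => [|[|k]] //; rewrite inE eqseq_cons andbF.
case: k => [|k].
  by apply/esym/and3P => -[_ /is_RG_gt0].
elim/last_ind: s => [|s a _].
  rewrite allowable_seqsS mem_cat; apply/negbTE/norP; split.
    by apply/mapP => -[[|? ?]].
  by apply/allpairsP => -[[[|? ?] ?] []].
rewrite allowable_seqsS mem_cat size_rcons eqSS allowable_rcons.
apply/orP/and3P => [[] | [/eqP sz_s]].
- case/mapP => s'; rewrite IHn => /and3P[/eqP sz_s RGs ok_s] /rcons_inj[-> ->].
  have s_gt0 := is_RG_size_gt0 RGs; have max_s := is_RG_max RGs.
  rewrite sz_s is_RG_rcons // max_s RGs ok_s (maxn_idPr _) ?leqnn //.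
  (* The letter [k.+1] exceeds the maximum of the prefix, so the parity condition is vacuous. *)
  split; rewrite /= ?eqxx //; apply/implyP => /mem_leq_prefix_max.
  by rewrite max_s ltnn.
- case/allpairsPdep => s' [b []]; rewrite IHn mem_filter mem_iota.
  move=> /and3P[/eqP sz_s RGs ok_s] /andP[odd_b b_bnd] /rcons_inj[-> ->].
  have s_gt0 := is_RG_size_gt0 RGs; have max_s := is_RG_max RGs.
  rewrite sz_s is_RG_rcons // max_s RGs ok_s odd_b implybT.
  by split=> //; lia.
rewrite is_RG_rcons ?sz_s // -sz_s => /and4P[RGs a_gt0 le_a /eqP max_a].
case/andP=> ok_s a_ok.
(* A letter up to the maximum already occurs by [is_RG_mem], hence is odd; a larger one must be
   [k.+1]. *)
have [le_aM | lt_Ma] := leqP a (prefix_max s (size s)).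
  move/maxn_idPl: (le_aM) max_a => -> max_s; right.
  apply: (allpairs_f rcons).
    by rewrite IHn sz_s eqxx ok_s -max_s RGs.
  rewrite mem_filter mem_iota (implyP a_ok) ?(is_RG_mem RGs) ?a_gt0 //=.
  by rewrite add1n ltnS -max_s.
left; have a_eq : a = k.+1 by move: max_a lt_Ma; lia.
rewrite a_eq; apply: map_f; rewrite IHn sz_s eqxx ok_s andbT /=.
suff <- : prefix_max s (size s) = k by [].
by move: le_a lt_Ma; rewrite a_eq; lia.
Qed.

Lemma uniq_allowable_seqs n k : uniq (allowable_seqs n k).
Proof.
elim: n k => [|n IHn] [|k] //; first by case: k.
rewrite allowable_seqsS cat_uniq map_inj_uniq => [|s t /rcons_inj[] //].
rewrite IHn andTb; apply/andP; split.
  (* The two halves are disjoint: a common word would have a prefix with both maxima [k] and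
     [k.+1]. *)
  apply/hasPn => _ /allpairsPdep[s [a [+ _ ->]]].
  rewrite mem_allowable_seqs => /and3P[_ /is_RG_max max_s _].
  apply/mapP => -[t + /rcons_inj[est _]].
  rewrite -est mem_allowable_seqs => /and3P[_ /is_RG_max + _].
  by rewrite max_s; lia.
apply: allpairs_uniq; rewrite ?IHn ?filter_uniq ?iota_uniq //.
by move=> [s a] [t b] _ _ /= /rcons_inj[-> ->].
Qed.

Lemma sum_allowable_words (V : nmodType) n k (F : seq nat -> V) :
  \sum_(w in allowable_words n.+1 k) F (word w) =
  \sum_(s <- allowable_seqs n k) F s.
Proof.
rewrite -big_enum /= -(big_map (@word n.+1 k) xpredT F); apply: perm_big.
apply: uniq_perm; rewrite ?uniq_allowable_seqs //.
  rewrite map_inj_uniq ?enum_uniq // => v w /(inj_map val_inj) ?.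
  exact: val_inj.
move=> s; rewrite mem_allowable_seqs andbA; apply/mapP/andP.
  case=> w; rewrite mem_enum inE => /andP[RGw ok_w] ->; split=> //.
  by apply/RG_wordsP; exists w.
case=> /RG_wordsP[w RGw <-] ok_w; exists w => //.
by rewrite mem_enum inE RGw.
Qed.

(** * The q-Stirling recurrence and its weights *)

Lemma qStirling_small n k : (n < k)%N -> qStirling n k = 0.
Proof. by case: n k => [|n] [|k] //= lt_nk; rewrite leqNgt lt_nk. Qed.

Lemma qStirlingS n k :
  qStirling n.+1 k.+1 = qStirling n k + qint k.+1 * qStirling n k.+1.
Proof.
rewrite /=; case: leqP => // lt_nk.
by rewrite !qStirling_small ?mulr0 ?addr0 //; lia.
Qed.

(** Each term covers the exponents [i] and [i.+1]; for odd [k] the last even index is [k.-1], so the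
    sum overshoots by ['X^k]. *)
Lemma sum_even_powers k :
  \sum_(0 <= i < k | ~~ odd i) 'X^i * (1 + 'X) =
  qint k + (if odd k then 'X^k else 0).
Proof.
rewrite /qint; elim: k => [|k IHk]; first by rewrite big_nil big_ord0 addr0.
rewrite big_mkcond big_nat_recr //= -big_mkcond IHk big_ord_recr /=.
by case: (odd k) => /=; rewrite ?addr0 // mulrDr mulr1 -exprSr addrA.
Qed.

Lemma qint_odd_letters k :
  qint k = \sum_(a <- [seq a <- iota 1 k | odd a])
    'X^(a.-1) * (1 + 'X) ^+ (a < k)%N.
Proof.
rewrite big_filter -{1}[1%N]addn0 -[iota _ _]/(iota (1 + 0) k) iotaDl big_map /=.
case: k => [|k]; first by rewrite /qint big_ord0 big_nil.
rewrite -[iota 0 _]/(index_iota 0 k.+1) big_mkcond big_nat_recr //=.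
rewrite (eq_big_nat _ _ (F2 := fun i => if ~~ odd i then 'X^i * (1 + 'X) else 0)).
  (* The power ['X^k] comes from the top letter [k.+1] if [k] is even, and from the overshoot if [k]
     is odd. *)
  rewrite -big_mkcond sum_even_powers /qint big_ord_recr /= ltnn expr0 mulr1.
  by case: odd; rewrite ?addr0.
by move=> i /andP[_ lt_ik]; rewrite add1n ltnS lt_ik expr1.
Qed.

Lemma qStirling_allowable_seqs n k :
  qStirling n.+1 k =
    \sum_(s <- allowable_seqs n k) 'X^(statA s) * (1 + 'X) ^+ (statB s).
Proof.
elim: n k => [|n IHn] [|k]; rewrite ?big_nil //.
  rewrite qStirlingS; case: k => [|k]; last by rewrite /= !mulr0 !big_nil addr0.
  by rewrite /= big_seq1 /statA /statB !big_nil mulr0 addr0 mulr1.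
rewrite qStirlingS !IHn allowable_seqsS big_cat big_map big_allpairs_dep /= mulr_sumr.
congr (_ + _); apply: eq_big_seq => s.
  rewrite mem_allowable_seqs => /and3P[_ RGs _].
  rewrite statA_rcons ?statB_rcons ?(is_RG_size_gt0 RGs) // (is_RG_max RGs).
  by rewrite ltnn ltnNge leqnSn !addn0.
rewrite mem_allowable_seqs => /and3P[_ RGs _].
rewrite qint_odd_letters mulr_suml big_seq [RHS]big_seq.
apply: eq_bigr => a; rewrite mem_filter mem_iota add1n ltnS => /and3P[_ _ le_a].
rewrite statA_rcons ?statB_rcons ?(is_RG_size_gt0 RGs) // (is_RG_max RGs) le_a.
by rewrite !exprD [RHS]mulrACA mulrC.
Qed.

(** * Evaluation at q = -1 *)

Lemma sorted_leq_rcons s a :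
  sorted leq (rcons s a) = sorted leq s && (prefix_max s (size s) <= a)%N.
Proof.
rewrite (sorted_pairwise leq_trans) pairwise_rcons andbC -(sorted_pairwise leq_trans).
congr (_ && _); rewrite prefix_max_size; apply/allP/bigmax_leqP_seq => ub_s x s_x.
  by move=> _; apply: ub_s.
exact: ub_s.
Qed.

(** By induction on the last letter: one below the maximum gives a factor 0, a new maximum gives 1,
    and one equal to the maximum gives an even power of -1. The empty product [0 ^+ 0] is 1. *)
Lemma signed_weight_allowable k s : is_RG k s -> allowable s ->
  (-1) ^+ statA s * 0 ^+ statB s = (sorted leq s)%:R :> int.
Proof.
elim/last_ind: s k => [|s a IHs] k; first by move/is_RG_size_gt0.
have [/size0nil->|s_gt0] := posnP (size s).
  by rewrite /statA /statB !big_nil mulr1.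
rewrite is_RG_rcons // allowable_rcons sorted_leq_rcons.
move=> /and4P[RGs a_gt0 le_a _] /andP[ok_s a_ok].
rewrite statA_rcons // statB_rcons // !exprD mulrACA (IHs _ RGs ok_s).
have [lt_aM | lt_Ma | eq_aM] := ltngtP a (prefix_max s (size s)).
- by rewrite /= expr1 !mulr0 andbF.
- by rewrite !mulr1 andbT.
(* The maximum already occurs in [s], so [a] is a repeated letter. *)
have odd_a : odd a.
  by apply: (implyP a_ok); apply: is_RG_mem RGs _; rewrite -eq_aM a_gt0 leqnn.
rewrite -signr_odd andbT (_ : odd a.-1 = false) ?mulr1 //.
by case: (a) odd_a => //= b /negbTE.
Qed.

Unset Implicit Arguments.
Theorem theorem3p2 (n k : nat) (n_ge1 : (1 <= n)%N) (k_bounds : (1 <= k <= n)%N) :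
  qStirling n k =
    \sum_(w in allowable_words n k)
       'X^(statA (word w)) * (1 + 'X) ^+ (statB (word w))
  /\
  (qStirling n k).[-1] =
    #|[set w in allowable_words n k | sorted leq (word w)]|%:R.
Proof.
case: n n_ge1 {k_bounds} => // n _; rewrite qStirling_allowable_seqs.
split; first by rewrite -sum_allowable_words.
(* The cardinal becomes a sum of indicators, to be compared term by term over the same list. *)
rewrite horner_sum -sumr_const (eq_bigl _ _ (in_set _)) /= big_mkcondr /=.
rewrite (sum_allowable_words n k (fun s => if sorted leq s then 1 else 0)).
apply: eq_big_seq => s; rewrite mem_allowable_seqs => /and3P[_ RGs ok_s].
rewrite -mulrb -(signed_weight_allowable RGs ok_s).
by rewrite hornerM !horner_exp hornerD hornerC hornerX subrr.
Qed.
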